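(* (Spread law) Let $\mathbb{F}$ be a field of characteristic not $2$ and let $B$ be an invertible symmetric $3\times 3$ matrix over $\mathbb{F}$. Let $\overline{v_1v_2v_3}$ be a vector triangle in $\mathbb{V}^3=\mathbb{F}^3$ whose $B$-spreads are defined (i.e. $v_1,v_2,v_3$ are all non-null), with $B$-quadrances $Q_1,Q_2,Q_3$, corresponding $B$-spreads $s_1,s_2,s_3$, and $B$-quadrea $\mathcal{A}$. Then $$\frac{s_1}{Q_1}=\frac{s_2}{Q_2}=\frac{s_3}{Q_3}=\frac{\mathcal{A}}{4Q_1Q_2Q_3}.$$
   Context: $\mathbb{V}^3$ is the space of row vectors over $\mathbb{F}$. The $B$-scalar product is $v\cdot_B w=vBw^T$, the $B$-quadrance is $Q_B(v)=v\cdot_B v$, and $v$ is null if $Q_B(v)=0$. A vector triangle $\overline{v_1v_2v_3}$ is an unordered collection of three vectors with $v_1+v_2+v_3=\mathbf{0}$. Its $B$-quadrances are $Q_i=Q_B(v_i)$. The $B$-spread of non-null vectors $v,w$ is $s_B(v,w)=1-\dfrac{(v\cdot_B w)^2}{Q_B(v)Q_B(w)}$ (undefined if $v$ or $w$ is null), and the $B$-spreads of the triangle are $s_1=s_B(v_2,v_3)$, $s_2=s_B(v_1,v_3)$, $s_3=s_B(v_1,v_2)$. The $B$-quadrea of the triangle is $\mathcal{A}=A(Q_1,Q_2,Q_3)$, where $A(a,b,c)=(a+b+c)^2-2(a^2+b^2+c^2)$. *)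

(* Defs.v *)
From mathcomp Require Import all_boot all_algebra.

Set Implicit Arguments.
Unset Strict Implicit.
Unset Printing Implicit Defensive.

Import GRing.Theory.
Local Open Scope ring_scope.

Definition bdot (F : fieldType) (B : 'M[F]_3) (v w : 'rV[F]_3) : F :=
  (v *m B *m w^T) 0 0.

Definition quadrance (F : fieldType) (B : 'M[F]_3) (v : 'rV[F]_3) : F :=
  bdot B v v.

Definition null_vec (F : fieldType) (B : 'M[F]_3) (v : 'rV[F]_3) : Prop :=
  quadrance B v = 0.

(* Meaningful only when v and w are both non-null; since
   0^-1 = 0, it is otherwise 1. *)
Definition spread (F : fieldType) (B : 'M[F]_3) (v w : 'rV[F]_3) : F :=
  1 - bdot B v w ^+ 2 / (quadrance B v * quadrance B w).

(* A vector triangle is represented by a labelling of its three vectors; the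
   condition does not depend on the labelling. *)
Definition vector_triangle (F : fieldType) (v1 v2 v3 : 'rV[F]_3) : Prop :=
  v1 + v2 + v3 = 0.

Definition archimedes (F : fieldType) (a b c : F) : F :=
  (a + b + c) ^+ 2 - 2%:R * (a ^+ 2 + b ^+ 2 + c ^+ 2).

Definition quadrea (F : fieldType) (B : 'M[F]_3) (v1 v2 v3 : 'rV[F]_3) : F :=
  archimedes (quadrance B v1) (quadrance B v2) (quadrance B v3).

(* Main.v *)
Require Import Defs.
From mathcomp Require Import all_boot all_algebra.
From mathcomp Require Import ring.
Import GRing.Theory.
Local Open Scope ring_scope.

(** In a triangle [u + v + w = 0], the vector [u] is [- (v + w)], so its
    quadrance expands to [Q u = Q v + Q w + 2 (v . w)] (the cosine law).
    Substituting this into Archimedes' function turns the quadrea into four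
    times the Gram determinant of [v] and [w]:
      [A = 4 (Q v * Q w - (v . w)^2)]  ([quadrea_gram]).
    The numerator of the spread of [v] and [w] over the denominator [Q v * Q w]
    is that same Gram determinant, so the ratio of the spread to the opposite
    quadrance [Q u] is [A / (4 Q u Q v Q w)] ([spread_over_quadrance]).
    The latter is symmetric in the three vectors, which makes the three ratios
    equal. *)

Section SpreadLaw.

Context {F : fieldType} {B : 'M[F]_3}.
Implicit Types u v w : 'rV[F]_3.

Lemma bdotDl u v w : bdot B (u + v) w = bdot B u w + bdot B v w.
Proof. by rewrite /bdot !mulmxDl mxE. Qed.

Lemma bdotDr u v w : bdot B u (v + w) = bdot B u v + bdot B u w.
Proof. by rewrite /bdot linearD mulmxDr mxE. Qed.

Lemma quadranceN v : quadrance B (- v) = quadrance B v.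
Proof. by rewrite /quadrance /bdot linearN mulmxN !mulNmx opprK. Qed.

(** A 1x1 matrix is its own transpose, and transposing [v B w^T] swaps the two
    vectors. *)
Lemma bdotC v w : B^T = B -> bdot B v w = bdot B w v.
Proof.
move=> B_sym; rewrite /bdot -[v *m B *m w^T]trmxK [LHS]mxE.
by rewrite !trmx_mul trmxK B_sym mulmxA.
Qed.

Lemma quadranceD v w : B^T = B ->
  quadrance B (v + w) = quadrance B v + quadrance B w + 2%:R * bdot B v w.
Proof.
move=> B_sym; rewrite /quadrance bdotDl !bdotDr (bdotC w v B_sym); ring.
Qed.

Lemma vector_triangle_swap12 u v w :
  vector_triangle u v w -> vector_triangle v u w.
Proof. by rewrite /vector_triangle (addrC u). Qed.

Lemma vector_triangle_rot u v w :
  vector_triangle u v w -> vector_triangle w u v.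
Proof. by rewrite /vector_triangle -(addrA w) (addrC w). Qed.

Lemma quadrea_swap12 u v w : quadrea B u v w = quadrea B v u w.
Proof. rewrite /quadrea /archimedes; ring. Qed.

Lemma quadrea_rot u v w : quadrea B u v w = quadrea B w u v.
Proof. rewrite /quadrea /archimedes; ring. Qed.

(** The cosine law eliminates [quadrance B u], and Archimedes' function of
    [b + c + 2 d], [b] and [c] is identically [4 (b c - d^2)]. *)
Lemma quadrea_gram u v w : B^T = B -> vector_triangle u v w ->
  quadrea B u v w =
    4%:R * (quadrance B v * quadrance B w - bdot B v w ^+ 2).
Proof.
move=> B_sym; rewrite /vector_triangle -addrA => /eqP; rewrite addr_eq0.
move=> /eqP->; rewrite /quadrea quadranceN quadranceD // /archimedes; ring.
Qed.

(** The common value of the three ratios; characteristic 2 is excluded so that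
    the factor 4 of the quadrea can be cancelled. *)
Lemma spread_over_quadrance u v w :
  2%N \notin [pchar F] -> B^T = B -> vector_triangle u v w ->
  quadrance B u != 0 -> quadrance B v != 0 -> quadrance B w != 0 ->
  spread B v w / quadrance B u =
    quadrea B u v w / (4%:R * quadrance B u * quadrance B v * quadrance B w).
Proof.
move=> char_neq2 B_sym tri Qu Qv Qw.
have nz2 : 2%:R != 0 :> F by move: char_neq2; rewrite inE.
have nz4 : 4%:R != 0 :> F by rewrite (natrM _ 2 2) mulf_neq0.
by rewrite quadrea_gram // /spread; field; rewrite Qu Qv Qw nz4.
Qed.

End SpreadLaw.

Theorem theorem21 (F : fieldType) (char_neq2 : 2%N \notin [pchar F])
    (B : 'M[F]_3) (B_inv : B \in unitmx) (B_sym : B^T = B)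
    (v1 v2 v3 : 'rV[F]_3) (tri : vector_triangle v1 v2 v3)
    (nonnull1 : ~ null_vec B v1) (nonnull2 : ~ null_vec B v2)
    (nonnull3 : ~ null_vec B v3) :
  let Q1 := quadrance B v1 in
  let Q2 := quadrance B v2 in
  let Q3 := quadrance B v3 in
  let s1 := spread B v2 v3 in
  let s2 := spread B v1 v3 in
  let s3 := spread B v1 v2 in
  [/\ s1 / Q1 = s2 / Q2,
      s2 / Q2 = s3 / Q3
    & s3 / Q3 = quadrea B v1 v2 v3 / (4%:R * Q1 * Q2 * Q3)].
Proof.
move=> Q1 Q2 Q3 s1 s2 s3.
have nz1 : Q1 != 0 by apply/eqP.
have nz2 : Q2 != 0 by apply/eqP.
have nz3 : Q3 != 0 by apply/eqP.
set r := _ / (4%:R * Q1 * Q2 * Q3).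
have r1 : s1 / Q1 = r by exact: spread_over_quadrance.
have r2 : s2 / Q2 = r.
  rewrite /s2 /Q2 spread_over_quadrance //; last exact: vector_triangle_swap12.
  by rewrite quadrea_swap12 -/Q1 -/Q2 -/Q3 /r; congr (_ / _); ring.
have r3 : s3 / Q3 = r.
  rewrite /s3 /Q3 spread_over_quadrance //; last exact: vector_triangle_rot.
  by rewrite -quadrea_rot -/Q1 -/Q2 -/Q3 /r; congr (_ / _); ring.
by rewrite r1 r2 r3.
Qed.
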